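(* Let $K$ be a compact Hausdorff space, let $B$ be a linear subspace of $C(K)$ containing $1$, and let $L=L_\mu\in\mathcal{S}(C(K))$ be the state represented by the positive Radon measure $\mu$ on $K$. Then $L$ is an extreme point of $[L]_{\sim_B}$ if and only if $B$ is dense in $\mathcal{L}^1(\mu)$ with respect to the $\mathcal{L}^1(\mu)$-norm.
   Context: $C(K)$ is the algebra of continuous real-valued functions on $K$ with the supremum norm. A state on $A=C(K)$ is a linear functional $L:A\to\mathbb{R}$ with $L(1)=1=\|L\|$ and $L(a)\ge0$ for all $a\in A$ with $a\ge0$ on $K$; $\mathcal{S}(A)$ is the set of states. Every $L\in\mathcal{S}(A)$ is of the form $L=L_\mu$, $L_\mu(a):=\int a\,d\mu$, for a positive Radon measure $\mu$ on $K$. The equivalence relation $\sim_B$ on $\mathcal{S}(A)$ is: $L_1\sim_B L_2$ iff $L_1|_B=L_2|_B$; $[L]_{\sim_B}\subseteq\mathcal{S}(A)$ denotes the equivalence class of $L$, which is a convex set. *)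

(* Defs.v *)
From HB Require Import structures.
From mathcomp Require Import all_boot all_order all_algebra.
From mathcomp Require Import all_classical all_reals all_analysis.

Set Implicit Arguments.
Unset Strict Implicit.
Unset Printing Implicit Defensive.
Import Order.TTheory GRing.Theory Num.Theory.
Import numFieldNormedType.Exports.

Set Warnings "-redundant-canonical-projection".

Local Open Scope classical_set_scope.
Local Open Scope ring_scope.

(* The library type [continuousType K R] is equipped with the pointwise        *)
(* commutative ring and R-algebra structures, as a subtype of [K -> R].        *)
Section continuous_algebra.
Context (K : ptopologicalType) (R : realType).

Definition cts : {pred K -> R} := mem [set f : K -> R | continuous f].

Section Sub.
Context (f : K -> R) (fP : f \in cts).
Definition cts_Sub_subproof := @isContinuous.Build K R f (set_mem fP).
#[local] HB.instance Definition _ := cts_Sub_subproof.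
Definition cts_Sub : continuousType K R := [the continuousType K R of f].
End Sub.

Lemma cts_rect (P : continuousType K R -> Type) :
  (forall f (fP : f \in cts), P (cts_Sub fP)) -> forall u, P u.
Proof.
move=> Psub [f [[Pf]]].
have fP : f \in cts by rewrite inE.
have -> : Pf = set_mem fP by exact: Prop_irrelevance.
exact: Psub.
Qed.

Lemma cts_valP f (fP : f \in cts) : cts_Sub fP = f :> (K -> R).
Proof. by []. Qed.

HB.instance Definition _ :=
  isSub.Build _ _ (continuousType K R) cts_rect cts_valP.

Lemma cts_subring_closed : subring_closed cts.
Proof.
split=> [|f g|f g].
- by rewrite inE => x; exact: cvg_cst.
- by rewrite !inE => cf cg x; apply: continuousB; [exact: cf|exact: cg].
- by rewrite !inE => cf cg x; apply: continuousM; [exact: cf|exact: cg].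
Qed.

HB.instance Definition _ := GRing.isSubringClosed.Build _ cts
  cts_subring_closed.

HB.instance Definition _ :=
  [SubChoice_isSubComNzRing of continuousType K R by <:].

Let scale (k : R) (f : continuousType K R) : continuousType K R :=
  (cst k : continuousType K R) * f.

Let scaleA a b f : scale a (scale b f) = scale (a * b) f.
Proof. by apply/val_inj/funext => x; exact: mulrA. Qed.

Let scale1 : left_id 1 scale.
Proof. by move=> f; apply/val_inj/funext => x; exact: mul1r. Qed.

Let scaleDr : right_distributive scale +%R.
Proof. by move=> a f g; apply/val_inj/funext => x; exact: mulrDr. Qed.

Let scaleDl f : {morph scale^~ f : a b / a + b}.
Proof. by move=> a b; apply/val_inj/funext => x; exact: mulrDl. Qed.

HB.instance Definition _ := GRing.Zmodule_isLmodule.Build R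
  (continuousType K R) scaleA scale1 scaleDr scaleDl.

Let scaleAl (k : R) (f g : continuousType K R) : k *: (f * g) = (k *: f) * g.
Proof. by apply/val_inj/funext => x; exact: mulrA. Qed.

HB.instance Definition _ := GRing.Lmodule_isLalgebra.Build R
  (continuousType K R) scaleAl.

Let scaleAr (k : R) (f g : continuousType K R) : k *: (f * g) = f * (k *: g).
Proof. by apply/val_inj/funext => x; exact: mulrCA. Qed.

HB.instance Definition _ := GRing.Lalgebra_isAlgebra.Build R
  (continuousType K R) scaleAr.

End continuous_algebra.

Section continuous_algebra_pointwise.
Context (K : ptopologicalType) (R : realType).
Implicit Types f g : continuousType K R.

Lemma cts_oneE x : (1 : continuousType K R) x = 1.
Proof. by []. Qed.

Lemma cts_addE f g x : (f + g) x = f x + g x.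
Proof. by []. Qed.

Lemma cts_oppE f x : (- f) x = - f x.
Proof. by []. Qed.

Lemma cts_mulE f g x : (f * g) x = f x * g x.
Proof. by []. Qed.

Lemma cts_scaleE (k : R) f x : (k *: f) x = k * f x.
Proof. by []. Qed.

End continuous_algebra_pointwise.

Section states.
Context (K : ptopologicalType) (R : realType).
Local Notation C := (continuousType K R).

(* For compact K the supremum is finite and attained. *)
Definition supnorm (a : C) : R := sup (range (fun x => `|a x|)).

Definition opnorm (L : C -> R) : \bar R :=
  ereal_sup [set `|L a|%:E | a in [set a : C | supnorm a <= 1]].

(* Functionals take their values in [R^o] so that [C -> R^o] is an R-module,   *)
(* in which convex combinations of states can be formed.                       *)
Definition states : set (C -> R^o) :=
  [set L : C -> R^o | [/\ linear L, L 1 = 1, opnorm L = 1%E &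
    forall a : C, (forall x, 0 <= a x) -> 0 <= L a]].

Definition state_equiv (B : set C) (L1 L2 : C -> R^o) : Prop :=
  {in B, L1 =1 L2}.

Definition state_class (B : set C) (L : C -> R^o) : set (C -> R^o) :=
  [set L' | states L' /\ state_equiv B L' L].

End states.

Definition extreme_point (R : realType) (V : lmodType R) (A : set V) (x : V) :
    Prop :=
  A x /\ forall (y z : V) (t : R), A y -> A z -> 0 < t -> t < 1 ->
    x = t *: y + (1 - t) *: z -> y = x /\ z = x.

(* [K] with its Borel sigma-algebra. The library asks measurable types to be  *)
(* pointed, whence [K : ptopologicalType]; this costs nothing, since C(K) has  *)
(* no state when K is empty.                                                   *)
Notation borelType K := (g_sigma_algebraType (@open K)).

Section radon.
Context (K : ptopologicalType) (R : realType).
Variable mu : {measure set (borelType K) -> \bar R}.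

(* Finite on compact sets and inner regular on all Borel sets. *)
Definition radon : Prop :=
  (forall C : set K, compact C -> (mu C < +oo)%E) /\
  (forall A : set (borelType K), measurable A ->
    mu A = ereal_sup [set mu C | C in [set C : set K | compact C /\ C `<=` A]]).

Definition L_mu : continuousType K R -> R^o :=
  fun a => \int[mu]_x a x.

(* [Lfun mu 1] is the space of functions, not its quotient by a.e. equality.   *)
Definition dense_L1 (B : set (continuousType K R)) : Prop :=
  forall f : borelType K -> R, f \in Lfun mu 1 ->
  forall e : R, 0 < e ->
  exists2 b : continuousType K R, b \in B &
    ('N[mu]_1[EFin \o (f \- b)%R] < e%:E)%E.

End radon.

(* Main.v *)
Require Import Defs.
From HB Require Import structures.
From mathcomp Require Import all_boot all_order all_algebra.
From mathcomp Require Import all_classical all_reals all_analysis.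
From mathcomp Require Import lra measurable_realfun.

(** The value [L_mu mu `|a|] is the L1-norm of [a], so a functional [Phi] on
    C(K) satisfies [Phi <= ||.||_1] exactly when it can be added to, and
    subtracted from, the state [L_mu mu] without losing positivity.

    If [B] is dense and [L = t y + (1 - t) z] with [y], [z] states that agree
    with [L] on [B], then positivity gives [t |y a| <= L |a|]
    ([state_dominated]).  So [y] is continuous for the L1-norm, and equals [L]
    because it does so on the dense set [B] ([dense_dominated_eq]); the same
    holds for [z].

    Conversely, continuous functions are dense in L1 ([cts_dense]: simple
    functions, inner regularity and Urysohn's lemma).  Hence if [B] is not
    dense in L1, some continuous [a] has positive L1-distance to [B].  The
    Hahn-Banach theorem, in the form [mazur_orlicz], yields a linear
    [Phi <= ||.||_1] on C(K) that vanishes on [B] but not at [a].  Then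
    [L + Phi] and [L - Phi] are states ([state_perturbation]) that agree with
    [L] on [B], and [L] is their midpoint, so it is not extreme.  Applying
    Hahn-Banach to C(K) with the L1-seminorm makes the duality between L1 and
    L-infinity unnecessary. *)

Set Implicit Arguments.
Unset Strict Implicit.
Unset Printing Implicit Defensive.
Import Order.TTheory GRing.Theory Num.Theory.
Import numFieldNormedType.Exports.
Import HBSimple.

Local Open Scope classical_set_scope.
Local Open Scope ring_scope.

(** * Sublinear functionals and the Hahn-Banach theorem *)

Section sublinear.
Context (R : realType) (V : lmodType R).
Implicit Types (q : V -> R) (D : set (V * R)).

(** Homogeneity is required for positive scalars only; it forces [q 0 = 0]. *)
Definition sublinear q :=
  (forall x y, q (x + y) <= q x + q y) /\
  (forall (c : R) x, 0 < c -> q (c *: x) = c * q x).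

Lemma sublinear0 q : sublinear q -> q 0 = 0.
Proof.
move=> [_ qZ]; have := qZ 2 0 (ltr0Sn _ _); rewrite scaler0 => q0; lra.
Qed.

Lemma sublinear_geN q x : sublinear q -> - q (- x) <= q x.
Proof.
move=> sq; have [qD _] := sq.
by rewrite lerNl -subr_ge0 opprK addrC -(sublinear0 sq) -(subrr x) qD.
Qed.

(** A pointwise infimum of functionals is sublinear as soon as the family is
    sublinear collectively: the member of the family may change when vectors
    are added or scaled.  This covers chains of sublinear functionals as well
    as the shifts by a cone below. *)
Lemma sublinear_inf (T : Type) (A : set T) (F : T -> V -> R) :
  A !=set0 ->
  (forall x, has_lbound [set F s x | s in A]) ->
  (forall s t x y, A s -> A t ->
    exists2 u, A u & F u (x + y) <= F s x + F t y) ->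
  (forall (c : R) s x, 0 < c -> A s ->
    exists2 u, A u & F u (c *: x) <= c * F s x) ->
  sublinear (fun x => inf [set F s x | s in A]).
Proof.
move=> [s0 As0] lbF FD FZ.
have inf_ub s x : A s -> inf [set F s x | s in A] <= F s x.
  by move=> As; apply: ge_inf => //; exists s.
have lb_inf x r : (forall s, A s -> r <= F s x) -> r <= inf [set F s x | s in A].
  move=> rF; apply: lb_le_inf; first by exists (F s0 x), s0.
  by move=> _ [s As <-]; exact: rF.
have infZ (c : R) x : 0 < c ->
    inf [set F s (c *: x) | s in A] <= c * inf [set F s x | s in A].
  move=> c0; rewrite -ler_pdivrMl//; apply: lb_inf => s As.
  rewrite ler_pdivrMl//; have [u Au /(le_trans _)] := FZ _ _ x c0 As.
  by apply; exact: inf_ub.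
split=> [x y|c x c0].
- rewrite -lerBlDl; apply: (lb_inf) => t At; rewrite lerBlDr -lerBlDl.
  apply: lb_inf => s As; rewrite lerBlDr.
  have [u Au /(le_trans _)] := FD _ _ x y As At.
  by apply; exact: inf_ub.
- apply/eqP; rewrite eq_le infZ//= -ler_pdivlMl//.
  have cV0 : 0 < c^-1 by rewrite invr_gt0.
  have := infZ _ (c *: x) cV0.
  by rewrite scalerA mulVf ?gt_eqF// scale1r.
Qed.

(** The convex cones of [V * R] containing the origin. *)
Definition pointed_cone D := [/\ D (0, 0),
  forall d e, D d -> D e -> D (d.1 + e.1, d.2 + e.2) &
  forall (c : R) d, 0 < c -> D d -> D (c *: d.1, c * d.2)].

(** The functional [q' x = inf { q (x + v) + r | (v, r) in D }] is the largest
    sublinear minorant of [q] such that [q' (- v) <= r] on [D]. *)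
Lemma sublinear_shift q D : sublinear q -> pointed_cone D ->
  (forall d, D d -> 0 <= q d.1 + d.2) ->
  exists q', [/\ sublinear q', forall x, q' x <= q x &
    forall d, D d -> q' (- d.1) <= d.2].
Proof.
move=> sq [D0 DD DZ] Dq; have [qD qZ] := sq.
pose F (d : V * R) x := q (x + d.1) + d.2.
have lbF x : has_lbound [set F d x | d in D].
  exists (- q (- x)) => _ [d Dd <-]; rewrite /F.
  have := qD (x + d.1) (- x); rewrite addrAC subrr add0r.
  by move: (Dq _ Dd) => {sq qD qZ Dq}; lra.
exists (fun x => inf [set F d x | d in D]); split=> [|x|d Dd].
- apply: sublinear_inf => //.
  + by exists (0, 0).
  + move=> d e x y Dd De; exists (d.1 + e.1, d.2 + e.2); first exact: DD.
    rewrite /F/= addrACA [leRHS]addrACA lerD2r; exact: qD.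
  + move=> c d x c0 Dd; exists (c *: d.1, c * d.2); first exact: DZ.
    by rewrite /F/= -scalerDr qZ// mulrDr.
- apply: le_trans (ge_inf (lbF x) _) _; first by exists (0, 0).
  by rewrite /F/= !addr0.
- apply: le_trans (ge_inf (lbF _) _) _; first by exists d.
  by rewrite /F addNr sublinear0// add0r.
Qed.

(** Zorn's lemma: the infimum of a chain of sublinear minorants of [q] stays
    above [- q (- x)], hence is finite. *)
Lemma minimal_sublinear q : sublinear q ->
  exists q', [/\ sublinear q', forall x, q' x <= q x &
    forall r, sublinear r -> (forall x, r x <= q' x) -> r = q'].
Proof.
move=> sq.
pose T := {r : V -> R | sublinear r /\ forall x, r x <= q x}.
pose rle (r s : T) := `[< forall x, sval s x <= sval r x >].
have chain (A : set T) : total_on A rle -> exists t, forall s, A s -> rle s t.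
  move=> totA; have [[s0 As0]|A0] := pselect (A !=set0); last first.
    exists (exist _ q (conj sq (fun x => lexx (q x))) : T) => s As.
    by exfalso; apply: A0; exists s.
  have lbA x : has_lbound [set sval s x | s in A].
    exists (- q (- x)) => _ [s As <-].
    have [ss sleq] := svalP s.
    by apply: le_trans (sublinear_geN x ss); rewrite lerN2.
  have si : sublinear (fun x => inf [set sval s x | s in A]).
    apply: sublinear_inf => //; first by exists s0.
    - move=> s t x y As At; have [[sD _] _] := svalP s.
      have [[tD _] _] := svalP t.
      have [/asboolP st|/asboolP ts] := totA _ _ As At.
      + by exists t => //; apply: le_trans (tD _ _) _; rewrite lerD2r.
      + by exists s => //; apply: le_trans (sD _ _) _; rewrite lerD2l.
    - move=> c s x c0 As; exists s => //; have [[_ sZ] _] := svalP s.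
      by rewrite sZ.
  have iq x : inf [set sval s x | s in A] <= q x.
    have [_ /(_ x)] := svalP s0; apply: le_trans.
    by apply: ge_inf => //; exists s0.
  exists (exist _ (fun x => inf [set sval s x | s in A]) (conj si iq) : T).
  move=> s As; apply/asboolP => x /=.
  by apply: ge_inf => //; exists s.
have [| | |[r [sr rq]] rmin] := @Zorn T rle _ _ _ chain.
- by move=> r; apply/asboolP.
- move=> r s t /asboolP rs /asboolP st; apply/asboolP => x.
  exact: le_trans (st x) (rs x).
- move=> [s sP] [t tP] /asboolP/= st /asboolP/= ts; apply: eq_exist.
  apply/funext => x.
  by apply/eqP; rewrite eq_le st ts.
exists r; split=> // s ss sr'.
have sq' x : s x <= q x by apply: le_trans (rq x).
have := rmin (exist _ s (conj ss sq') : T).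
by move=> /(_ (introT (asboolP _) sr')) /(congr1 sval).
Qed.

(** Shifting a minimal [q] along the ray spanned by [(a, - q a)] cannot
    decrease it, so [q (- a) <= - q a] for every [a], which forces
    additivity. *)
Lemma minimal_sublinear_linear q : sublinear q ->
  (forall r, sublinear r -> (forall x, r x <= q x) -> r = q) ->
  linear (q : V -> R^o).
Proof.
move=> sq qmin; have [qD qZ] := sq.
have qadd x a : q (x + a) = q x + q a.
  apply/eqP; rewrite eq_le qD/=.
  pose D := [set d : V * R | exists2 t : R, 0 <= t & d = (t *: a, - (t * q a))].
  have [|d [t t0 ->]/=|r [sr rq rD]] := @sublinear_shift q D sq.
  - split=> [|_ _ [s s0 ->] [t t0 ->]|c _ c0 [t t0 ->]].
    + by exists 0 => //; rewrite scale0r mul0r oppr0.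
    + exists (s + t); first exact: addr_ge0.
      by rewrite /= scalerDl mulrDl opprD.
    + exists (c * t); first by rewrite mulr_ge0// ltW.
      by rewrite /= scalerA mulrN mulrA.
  - move: t0; rewrite le_eqVlt => /predU1P[<-|t0].
      by rewrite scale0r sublinear0// mul0r subrr.
    by rewrite qZ// subrr.
  have rqE := qmin _ sr rq; rewrite rqE in rD.
  have D1 : D (1 *: a, - (1 * q a)) by exists 1.
  move: (rD _ D1); rewrite /= scale1r mul1r => qNa.
  have := qD (x + a) (- a); rewrite addrK; lra.
have qN x : q (- x) = - q x.
  by apply/eqP; rewrite -addr_eq0 -qadd addNr sublinear0.
have qscale (c : R) x : q (c *: x) = c * q x.
  have [c0|c0|->] := ltgtP c 0.
  - apply: oppr_inj; rewrite -qN -scaleNr -mulNr.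
    by apply: qZ; rewrite oppr_gt0.
  - exact: qZ.
  - by rewrite scale0r mul0r sublinear0.
by move=> c x y; rewrite qadd qscale.
Qed.

(** Hahn-Banach theorem in the form of Mazur and Orlicz: linear minorants of
    [q] can be found under the constraints [- r <= Phi v], [(v, r)] in [D],
    whenever [q] itself satisfies them. *)
Lemma mazur_orlicz q D : sublinear q -> pointed_cone D ->
  (forall d, D d -> 0 <= q d.1 + d.2) ->
  exists Phi : V -> R^o, [/\ linear Phi, forall x, Phi x <= q x &
    forall d, D d -> 0 <= Phi d.1 + d.2].
Proof.
move=> sq cD Dq; have [q1 [sq1 q1q q1D]] := sublinear_shift sq cD Dq.
have [q2 [sq2 q2q1 q2min]] := minimal_sublinear sq1.
have linq2 := minimal_sublinear_linear sq2 q2min.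
exists q2; split=> // [x|d Dd].
  exact: le_trans (q1q x).
have := le_trans (q2q1 _) (q1D _ Dd).
have := sublinear_geN d.1 sq2; lra.
Qed.

End sublinear.

(** * The L1-norm of real functions *)

Section l1norm.
Context d (T : measurableType d) (R : realType).
Variable mu : {measure set T -> \bar R}.
Implicit Types f g h : T -> R.

(** The L1-norm as a real number; it is meaningful for integrable [f], as the
    real-valued integral takes the default value 0 when the integral of [|f|]
    is infinite. *)
Definition l1norm f : R := \int[mu]_x `|f x|.

Local Notation intg f := (mu.-integrable setT (EFin \o f)).

Lemma integrableD_EFin f g : intg f -> intg g -> intg (f \+ g).
Proof. by move=> fi gi; exact: eq_integrable (integrableD _ fi gi). Qed.

Lemma integrableB_EFin f g : intg f -> intg g -> intg (f \- g).
Proof. by move=> fi gi; exact: eq_integrable (integrableB _ fi gi). Qed.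

Lemma integrableZ_EFin (c : R) f : intg f -> intg (fun x => c * f x).
Proof. by move=> fi; exact: eq_integrable (integrableZl _ c fi). Qed.

Lemma Lnorm1_l1norm f : intg f -> ('N[mu]_1[EFin \o f] = (l1norm f)%:E)%E.
Proof.
move=> fi; rewrite Lnorm1 /l1norm /Rintegral fineK//.
exact/integrable_fin_num/integrable_norm.
Qed.

Lemma le_l1norm f g : intg f -> intg g -> (forall x, `|f x| <= g x) ->
  l1norm f <= \int[mu]_x g x.
Proof.
by move=> fi gi fg; apply: le_Rintegral => //; exact: integrable_norm.
Qed.

Lemma l1normD f g : intg f -> intg g -> l1norm (f \+ g) <= l1norm f + l1norm g.
Proof.
move=> fi gi; rewrite /l1norm -RintegralD//; [|exact: integrable_norm..].
apply: le_l1norm; first exact: integrableD_EFin.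
  by apply: (integrableD_EFin (integrable_norm fi) (integrable_norm gi)).
by move=> x; exact: ler_normD.
Qed.

Lemma l1normZ (c : R) f : intg f -> l1norm (fun x => c * f x) = `|c| * l1norm f.
Proof.
move=> fi; rewrite /l1norm -RintegralZl//; last exact: integrable_norm.
by apply: eq_Rintegral => x _; rewrite normrM.
Qed.

End l1norm.

(** * Density of the continuous functions in L1 *)

Section continuous_integrable.
Context (R : realType) (K : ptopologicalType).
Hypothesis cK : compact [set: K].
Variable mu : {measure set (borelType K) -> \bar R}.
Hypothesis mu_radon : radon mu.
Local Notation C := (continuousType K R).
Local Notation intg f := (mu.-integrable setT (EFin \o f)).

Lemma open_borel (A : set K) : open A -> measurable (A : set (borelType K)).
Proof. by move=> oA; exact: sub_sigma_algebra. Qed.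

Lemma closed_borel (A : set K) : closed A -> measurable (A : set (borelType K)).
Proof.
move=> cA; have /measurableC := open_borel (closed_openC cA).
by rewrite setCK.
Qed.

Lemma cts_measurable (a : C) : measurable_fun setT (a : borelType K -> R).
Proof.
apply: (measurability _ (RGenOpens.measurableE R)).
move=> _ [_ [x [y ->] <-]]; rewrite setTI; apply: open_borel.
have /continuousP := @cts_fun _ _ a; apply; exact: interval_open.
Qed.

Lemma cts_bounded (a : C) : exists M : R, forall x, `|a x| <= M.
Proof.
have : compact (range a).
  apply: continuous_compact => //; apply: continuous_subspaceT; exact: cts_fun.
move=> /compact_bounded[M [_ aM]].
by exists (M + 1) => x; apply: (aM (M + 1)); [rewrite ltrDl|exists x].
Qed.

Lemma radon_finite : (mu setT < +oo)%E.
Proof. by have [+ _] := mu_radon; apply. Qed.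

Lemma bounded_integrable (f : borelType K -> R) (M : R) :
  measurable_fun setT f -> (forall x, `|f x| <= M) -> intg f.
Proof.
move=> mf fM; apply: measurable_bounded_integrable => //.
  exact: radon_finite.
exists M; split; first by rewrite num_real.
by move=> r Mr x _; exact: le_trans (fM x) (ltW Mr).
Qed.

Lemma cts_integrable (a : C) : intg a.
Proof.
have [M aM] := cts_bounded a.
exact: (bounded_integrable (cts_measurable a) aM).
Qed.

Lemma indic_integrable (A : set (borelType K)) : measurable A -> intg (\1_A : _ -> R).
Proof.
move=> mA; apply: (@bounded_integrable _ 1); first exact: measurable_indic.
by move=> x; rewrite indicE; case: (_ \in _); rewrite ?normr1 ?normr0.
Qed.

Lemma Rintegral_indic (A : set (borelType K)) : measurable A ->
  \int[mu]_x (\1_A x : R) = fine (mu A).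
Proof. by move=> mA; rewrite /Rintegral integral_indic// setIT. Qed.

(** [f] lies in the L1-closure of C(K). *)
Definition cts_approximable (f : borelType K -> R) := forall e : R, 0 < e ->
  exists a : C, l1norm mu (f \- a) < e.

Lemma cts_approximableD f g : intg f -> intg g -> 
  cts_approximable f -> cts_approximable g -> cts_approximable (f \+ g).
Proof.
move=> fi gi fa ga e e0; have e20 : 0 < e / 2 by rewrite divr_gt0.
have [a fae] := fa _ e20; have [b gbe] := ga _ e20.
exists (a + b); rewrite (splitr e); apply: le_lt_trans (ltrD fae gbe).
have fai := integrableB_EFin fi (cts_integrable a).
have gbi := integrableB_EFin gi (cts_integrable b).
apply: le_trans (l1normD fai gbi).
rewrite le_eqVlt; apply/orP; left; apply/eqP.
apply: eq_Rintegral => x _ /=; rewrite -[LHS]/(`|f x + g x - (a x + b x)|).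
by rewrite opprD addrACA.
Qed.

Lemma cts_approximableZ (c : R) f : intg f -> 
  cts_approximable f -> cts_approximable (fun x => c * f x).
Proof.
move=> fi fa e e0; have c0 : 0 < `|c| + 1 by rewrite ltr_wpDl.
have [a fae] := fa _ (divr_gt0 e0 c0).
exists (c *: a); have fai := integrableB_EFin fi (cts_integrable a).
have -> : (fun x => c * f x) \- (c *: a) = (fun x => c * (f \- a) x).
  apply/funext => x; rewrite -[LHS]/(c * f x - c * a x) -[RHS]/(c * (f x - a x)).
  by rewrite mulrBr.
rewrite l1normZ//; move: fae; rewrite ltr_pdivlMr//; apply: le_lt_trans.
by rewrite mulrC ler_wpM2l ?lerDl//; apply: Rintegral_ge0.
Qed.

Lemma cts_approximable_sum (I : Type) (s : seq I) (c : I -> R)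
    (F : I -> borelType K -> R) :
  (forall i, intg (F i)) -> (forall i, cts_approximable (F i)) ->
  cts_approximable (fun x => \sum_(i <- s) c i * F i x).
Proof.
move=> Fi Fa.
suff [] : intg (fun x => \sum_(i <- s) c i * F i x) /\
  cts_approximable (fun x => \sum_(i <- s) c i * F i x) by [].
elim: s => [|i s [IHi IHa]].
  under eq_fun do rewrite big_nil.
  split; first exact: (cts_integrable 0).
  move=> e e0; exists 0; rewrite /l1norm (_ : Rintegral _ _ _ = 0)//.
  rewrite -[RHS](@Rintegral_set0 _ _ _ mu (cst 0)).
  rewrite /Rintegral integral_set0 integral0_eq// => x _ /=.
  by rewrite subrr normr0.
under eq_fun do rewrite big_cons.
have ciF : intg (fun x => c i * F i x) by exact: integrableZ_EFin.
split; first exact: integrableD_EFin.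
by apply: cts_approximableD => //; exact: cts_approximableZ.
Qed.

Hypothesis hausK : hausdorff_space K.

(** Inner regularity, with closed sets in place of compact ones. *)
Lemma inner_approx (A : set (borelType K)) (e : R) : measurable A -> 0 < e ->
  exists2 F : set K, closed F /\ F `<=` A & fine (mu (A `\` F)) < e.
Proof.
move=> mA e0; have [_ /(_ _ mA) muA] := mu_radon.
have fin B : measurable B -> mu B \is a fin_num.
  move=> mB; rewrite ge0_fin_numE//; apply: le_lt_trans radon_finite.
  by apply: le_measure; rewrite ?inE.
have finA := fin _ mA; rewrite muA in finA.
have [_ [F [cF FA] <-] +] := ub_ereal_sup_adherent e0 finA.
rewrite -muA => AF; have clF := compact_closed hausK cF.
exists F => //; have mF := closed_borel clF.
rewrite measureD//; last by rewrite (le_lt_trans _ radon_finite)// le_measure ?inE.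
rewrite setIidr// fineB ?fin//.
rewrite -lte_fin EFinB !fineK ?fin//.
by rewrite lteBlDr ?fin// -lteBlDl.
Qed.

(** Take closed sets [F] inside [A] and [G] inside its complement that exhaust
    them up to [e / 2].  A Urysohn function [u] equal to 1 on [F] and to 0 on
    [G] differs from the indicator of [A] only outside of [F] and [G]. *)
Lemma cts_approximable_indic (A : set (borelType K)) : measurable A ->
  cts_approximable (\1_A).
Proof.
move=> mA e e0; have e20 : 0 < e / 2 by rewrite divr_gt0.
have mA' := measurableC mA.
have [F [clF FA] muF] := inner_approx mA e20.
have [G [clG GA] muG] := inner_approx mA' e20.
have GF0 : G `&` F = set0.
  by apply/seteqP; split => // x [/GA Ax /FA].
have /uniform_separatorP := normal_uniform_separator
  (compact_normal hausK cK) clG clF GF0.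
move=> /(_ R)[u [cu u01 uG uF]].
have uC : u \in (@cts K R) by rewrite inE.
have mAF : measurable (A `\` F) by apply: measurableD => //; exact: closed_borel.
have mAG : measurable (~` A `\` G) by apply: measurableD => //; exact: closed_borel.
exists (cts_Sub uC); rewrite (splitr e); apply: le_lt_trans (ltrD muF muG).
rewrite -!Rintegral_indic// -RintegralD//; try exact: indic_integrable.
apply: le_l1norm.
- apply: integrableB_EFin; [exact: indic_integrable|exact: cts_integrable].
- by apply: integrableD_EFin; exact: indic_integrable.
move=> x; rewrite -[leLHS]/(`|\1_A x - u x|)
  -[leRHS]/(\1_(A `\` F) x + \1_(~` A `\` G) x).
have : u x \in `[0, 1] by apply: u01; exists x.
rewrite in_itv/= => /andP[u0 u1]; rewrite !indicE !in_setD in_setC.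
have [xA|xA] := boolP (x \in A) => /=.
  rewrite addr0; have [xF|xF] := boolP (x \in F) => /=.
    have -> : u x = 1 by apply: uF; exists x => //; exact: set_mem.
    by rewrite subrr normr0.
  by rewrite ger0_norm ?subr_ge0// gerBl.
rewrite !add0r normrN; have [xG|xG] := boolP (x \in G) => /=.
  have -> : u x = 0 by apply: uG; exists x => //; exact: set_mem.
  by rewrite normr0.
by rewrite ger0_norm.
Qed.

Lemma cts_dense f : intg f -> cts_approximable f.
Proof.
move=> fi e e0; have e20 : 0 < e / 2 by rewrite divr_gt0.
have [s [si _ fs0]] := approximation_sfun_integrable measurableT fi.
have [n fsn] : exists n, l1norm mu (f \- s n) < e / 2.
  have /fine_cvgP[_ /cvgr0Pnorm_lt/(_ _ e20)[n _ /(_ n (leqnn n))]] := fs0.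
  rewrite /= => fsn; exists n; apply: le_lt_trans fsn.
  exact: ler_norm.
have fsi := integrableB_EFin fi (si n).
have [a sae] : exists a : C, l1norm mu (s n \- a) < e / 2.
  have : cts_approximable (s n); last by apply.
  rewrite (funext (fimfunEord (s n))).
  apply: cts_approximable_sum => i; first by apply: indic_integrable.
  exact: cts_approximable_indic.
exists a; rewrite (splitr e); apply: le_lt_trans (ltrD fsn sae).
have sai := integrableB_EFin (si n) (cts_integrable a).
apply: le_trans (l1normD fsi sai).
rewrite le_eqVlt; apply/orP; left; apply/eqP.
by apply: eq_Rintegral => x _ /=; rewrite addrA subrK.
Qed.

End continuous_integrable.

(** * States and functionals dominated by the L1-norm *)

Section linear_functional.
Context (R : realType) (V : lmodType R) (L : V -> R^o).
Hypothesis linL : linear L.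

(** [L] bundled with its linearity. *)
Local Definition linear_pack : {linear V -> R^o} :=
  HB.pack L (GRing.isLinear.Build R V R^o *:%R L linL).

Lemma linfunB x y : L (x - y) = (L x : R) - (L y : R).
Proof. exact: (linearB linear_pack). Qed.

Lemma linfunN x : L (- x) = - (L x : R).
Proof. exact: (linearN linear_pack). Qed.

End linear_functional.

Section states_theory.
Context (R : realType) (K : ptopologicalType).
Hypothesis cK : compact [set: K].
Local Notation C := (continuousType K R).

Lemma ler_supnorm (a : C) x : `|a x| <= supnorm a.
Proof.
have [M aM] := cts_bounded cK a.
by apply: ub_le_sup; [exists M => _ [y _ <-]|exists x].
Qed.

Lemma positive_le (L : C -> R^o) : linear L ->
  (forall a : C, (forall x, 0 <= a x) -> 0 <= L a) ->
  forall a b : C, (forall x, a x <= b x) -> L a <= L b.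
Proof.
move=> linL L0 a b ab; rewrite -subr_ge0 -linfunB//; apply: L0 => x.
by rewrite -[leRHS]/(b x - a x) subr_ge0.
Qed.

(** The norm condition on states follows from positivity and [L 1 = 1]. *)
Lemma positive_state (L : C -> R^o) : linear L -> L 1 = 1 ->
  (forall a : C, (forall x, 0 <= a x) -> 0 <= L a) -> states L.
Proof.
move=> linL L1 L0; split => //; apply/eqP; rewrite eq_le; apply/andP; split.
- apply: ge_ereal_sup => _ [a /= a1 <-]; rewrite lee_fin.
  have aP x := le_trans (ler_supnorm a x) a1.
  rewrite ler_norml -L1 -linfunN//; apply/andP.
  by split; apply: positive_le => // x; have := aP x; rewrite ler_norml => /andP[].
- apply: ereal_sup_ubound; exists 1; last by rewrite L1 normr1.
  rewrite /= /supnorm.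
  suff -> : range (fun x => `|(1 : C) x|) = [set 1] by rewrite sup1.
  apply/seteqP; split => [_ [x _ <-]|_ ->] /=; first exact: normr1.
  by exists point => //; exact: normr1.
Qed.

Variable mu : {measure set (borelType K) -> \bar R}.
Hypothesis mu_radon : radon mu.

Lemma l1norm_sublinear : sublinear (fun a : C => l1norm mu a).
Proof.
split=> [a b|c a c0].
  exact: (l1normD (cts_integrable cK mu_radon a) (cts_integrable cK mu_radon b)).
rewrite -[X in X * _](gtr0_norm c0).
exact: (l1normZ c (cts_integrable cK mu_radon a)).
Qed.

Lemma l1normN_cts (a : C) : l1norm mu (- a) = l1norm mu a.
Proof. by apply: eq_Rintegral => x _; exact: normrN. Qed.

Lemma l1norm_ge0_cts (a : C) : (forall x, 0 <= a x) -> l1norm mu a = L_mu mu a.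
Proof. by move=> a0; apply: eq_Rintegral => x _; rewrite ger0_norm. Qed.

Lemma le_L_mu_l1norm (a : C) : `|L_mu mu a| <= l1norm mu a.
Proof. by apply: le_normr_Rintegral => //; exact: cts_integrable. Qed.

(** Positivity of [L_mu mu + Phi]: if [a >= 0] then
    [- Phi a <= l1norm mu a = L_mu mu a]. *)
Lemma state_perturbation (Phi : C -> R^o) : states (L_mu mu) -> linear Phi ->
  Phi 1 = 0 -> (forall a, Phi a <= l1norm mu a) ->
  states (L_mu mu + Phi : C -> R^o).
Proof.
move=> [linL L1 _ _] linPhi Phi1 Phip; apply: positive_state => [k a b||a a0].
- rewrite -[LHS]/(L_mu mu (k *: a + b) + Phi (k *: a + b)) linL linPhi.
  by rewrite addrACA -scalerDr.
- by rewrite -[LHS]/(L_mu mu 1 + Phi 1) L1 Phi1 addr0.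
- rewrite -[leRHS]/(L_mu mu a + Phi a) -lerBlDr sub0r -linfunN//.
  by rewrite -l1norm_ge0_cts// -l1normN_cts.
Qed.

Lemma state_dominated (y z : C -> R^o) (t : R) :
  states y -> states z -> 0 < t -> t < 1 ->
  L_mu mu = t *: y + (1 - t) *: z ->
  forall a, `|y a| <= t^-1 * l1norm mu a.
Proof.
move=> [liny _ _ y0] [_ _ _ z0] t0 t1 LE a.
have absC : (fun x => `|a x|) \in (@cts K R).
  rewrite inE => x; apply: (@continuous_comp _ _ _ a Num.norm).
    exact: cts_fun.
  exact: norm_continuous.
pose b : C := cts_Sub absC.
have bp : l1norm mu a = L_mu mu b by [].
have b0 x : 0 <= b x by exact: normr_ge0.
have yb : y b <= t^-1 * l1norm mu a.
  rewrite bp LE -[X in _ <= _ * X]/(t * y b + (1 - t) * z b).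
  rewrite ler_pdivlMl// lerDl mulr_ge0 ?subr_ge0 ?z0//; exact: ltW.
apply: le_trans yb; rewrite ler_norml lerNl -linfunN//; apply/andP.
split; apply: positive_le => // x; last exact: ler_norm.
by rewrite -[leLHS]/(- a x) -[leRHS]/(`|a x|) -normrN ler_norm.
Qed.

Lemma dense_dominated_eq (B : set C) (L y : C -> R^o) (c : R) :
  dense_L1 mu B -> linear L -> linear y -> L = L_mu mu -> 
  (forall a, `|y a| <= c * l1norm mu a) -> state_equiv B y L -> y = L.
Proof.
move=> dB linL liny LE yc yB; apply/funext => a.
apply/eqP; rewrite -subr_eq0 -normr_le0; apply/ler_addgt0Pl => e e0.
have c0 : 0 < `|c| + 1 by rewrite ltr_wpDl.
have ai := cts_integrable cK mu_radon a.
have [b bB] := dB a ((Lfun1_integrable mu a).2 ai) _ (divr_gt0 e0 c0).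
have abi := integrableB_EFin ai (cts_integrable cK mu_radon b).
rewrite Lnorm1_l1norm// lte_fin ltr_pdivlMr// => abe.
rewrite addr0; apply: le_trans (ltW abe).
have -> : (y a : R) - (L a : R) = (y (a - b) : R) - (L (a - b) : R).
  rewrite (linfunB liny) (linfunB linL) (yB b bB); lra.
apply: le_trans (ler_normB _ _) _.
rewrite mulrDr mulr1 lerD//.
  apply: le_trans (yc _) _; rewrite mulrC ler_wpM2l ?ler_norm//.
  exact: Rintegral_ge0.
by rewrite LE; exact: le_L_mu_l1norm.
Qed.

End states_theory.

(** * Extreme points of the classes of states *)

Theorem theorem3p3 (R : realType) (K : ptopologicalType)
  (hK : compact [set: K]) (hausK : hausdorff_space K)
  (B : set (continuousType K R)) (subB : submod_closed (mem B)) (B1 : 1 \in B)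
  (mu : {measure set (borelType K) -> \bar R}) (mu_radon : radon mu)
  (L : continuousType K R -> R^o) (stateL : states L) (L_repr : L = L_mu mu) :
  extreme_point (state_class B L) L <-> dense_L1 mu B.
Proof.
pose C := continuousType K R.
have [linL L1 _ L0] := stateL.
split=> [[_ extL]|dB]; last first.
  split; first by split.
  move=> y z t [sy yB] [sz zB] t0 t1 LE.
  have [liny _ _ _] := sy; have [linz _ _ _] := sz; rewrite L_repr in LE.
  split.
    apply: (dense_dominated_eq hK mu_radon dB) => //.
    exact: (state_dominated sy sz t0 t1 LE).
  have t0' : 0 < 1 - t by rewrite subr_gt0.
  have t1' : 1 - t < 1 by rewrite gtrBl.
  apply: (dense_dominated_eq hK mu_radon dB) => //.
  apply: (state_dominated sz sy t0' t1').
  by rewrite LE opprB addrCA subrr addr0 addrC.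
have [B0 BZD] := subB.
have BD a b : a \in B -> b \in B -> a + b \in B.
  by move=> aB bB; rewrite -[a]scale1r; exact: BZD.
have BZ (c : R) a : a \in B -> c *: a \in B.
  by move=> aB; rewrite -[_ *: _]addr0; exact: BZD.
have BN a : a \in B -> - a \in B by move=> aB; rewrite -scaleN1r; exact: BZ.
suff apxB (a : continuousType K R) (e : R) : 0 < e ->
    exists2 b, b \in B & l1norm mu (a - b : C) < e.
  move=> f /Lfun1_integrable fi e e0.
  have e20 : 0 < e / 2 by rewrite divr_gt0.
  have [a fae] := cts_dense hK mu_radon hausK fi e20.
  have [b bB abe] := apxB a _ e20.
  exists b => //.
  have ai := cts_integrable hK mu_radon a; have bi := cts_integrable hK mu_radon b.
  rewrite Lnorm1_l1norm; last exact: integrableB_EFin.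
  rewrite lte_fin (splitr e); apply: le_lt_trans (ltrD fae abe).
  have fai := integrableB_EFin fi ai; have abi := integrableB_EFin ai bi.
  apply: le_trans (l1normD fai abi).
  rewrite le_eqVlt; apply/orP; left; apply/eqP.
  by apply: eq_Rintegral => x _ /=; rewrite addrA subrK.
move=> e0; apply: contrapT => noB.
have farB b : b \in B -> e <= l1norm mu (a - b : C).
  by move=> bB; rewrite leNgt; apply/negP => abe; apply: noB; exists b.
have subp := l1norm_sublinear hK mu_radon.
(* The cone encodes [0 <= Phi] on [B] and [e <= Phi a] at the same time. *)
pose D := [set d : continuousType K R * R | exists b t,
  [/\ b \in B, 0 <= t & d = (b + t *: a, - (t * e))]].
have [||Phi [linPhi Phip PhiD]] := @mazur_orlicz _ _ _ D subp.
- split.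
  + by exists 0, 0; rewrite scale0r mul0r oppr0 addr0.
  + move=> _ _ [b [t [bB t0 ->]]] [b' [t' [b'B t'0 ->]]].
    exists (b + b'), (t + t'); split; [exact: BD|exact: addr_ge0|].
    by rewrite /= scalerDl mulrDl opprD addrACA.
  + move=> c _ c0 [b [t [bB t0 ->]]]; exists (c *: b), (c * t).
    split; [exact: BZ|by rewrite mulr_ge0// ltW|].
    by rewrite /= scalerDr scalerA mulrN mulrA.
- move=> _ [b [t [bB t0 ->]]].
  rewrite -[leRHS]/(l1norm mu (b + t *: a : C) - t * e) subr_ge0.
  move: t0; rewrite le_eqVlt => /predU1P[<-|t0].
    by rewrite mul0r; apply: Rintegral_ge0.
  have -> : b + t *: a = t *: (a - (- t^-1 *: b)).
    by rewrite scaleNr opprK scalerDr scalerA divff ?gt_eqF// scale1r addrC.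
  by rewrite (subp.2 t (a - (- t^-1 *: b)) t0) ler_pM2l//; apply: farB; exact: BZ.
have PhiB0 b : b \in B -> 0 <= Phi b.
  move=> bB; have := PhiD (b + 0 *: a, - (0 * e)).
  rewrite /= scale0r mul0r oppr0 !addr0; apply; exists b, 0.
  by rewrite scale0r mul0r oppr0 addr0.
have PhiB b : b \in B -> Phi b = 0.
  move=> bB; apply/eqP; rewrite eq_le PhiB0// andbT -oppr_ge0 -linfunN//.
  exact/PhiB0/BN.
have Phia : e <= Phi a.
  have := PhiD (0 + 1 *: a, - (1 * e)).
  rewrite /= scale1r mul1r add0r subr_ge0; apply; exists 0, 1.
  by rewrite scale1r mul1r add0r.
have linNPhi : linear (- Phi : _ -> R^o).
  by move=> k x y; rewrite -[LHS]/(- Phi (k *: x + y)) linPhi opprD -scalerN.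
have NPhip x : (- Phi) x <= l1norm mu x.
  by rewrite -[leLHS]/(- Phi x) -linfunN// -l1normN_cts.
have st1 : states (L + Phi : _ -> R^o).
  by rewrite L_repr; apply: state_perturbation => //; rewrite -?L_repr// PhiB.
have st2 : states (L - Phi : _ -> R^o).
  rewrite L_repr; apply: state_perturbation => //; rewrite -?L_repr//.
  by rewrite -[LHS]/(- Phi 1) PhiB// oppr0.
have [] := extL (L + Phi) (L - Phi) (2^-1).
- by split=> // b bB; rewrite -[LHS]/(L b + Phi b) PhiB// addr0.
- by split=> // b bB; rewrite -[LHS]/(L b - Phi b) PhiB// subr0.
- by [].
- by rewrite invf_lt1// ltr1n.
- rewrite [1 - _](_ : _ = 2^-1); last by lra.
  apply/funext => x.
  rewrite -[RHS]/(2^-1 * (L x + Phi x) + 2^-1 * (L x - Phi x) : R); lra.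
move=> /(congr1 (fun f => f a)); rewrite -[LHS]/(L a + Phi a) => LPhi _.
have : Phi a = 0 by apply: (addrI (L a)); rewrite addr0.
by move: Phia => /[swap] ->; rewrite leNgt e0.
Qed.
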